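(* Let $n$ be a positive integer and let $(Y_{1,1},\ldots,Y_{n,n})$ be a uniform random variable on the set $\mathcal{Y}_{n,n}$. Then for every integer $k\in[1,n]$, the $k$-tuple $$(Y_{1,n-k+1},Y_{2,n-k+2},\ldots,Y_{k-1,n-1},Y_{k,n})$$ has a marginal density on $[0,1]^k$ proportional to $$\mathbf{1}_{\{x_1\leq x_2\leq\cdots\leq x_k\}}\,\Delta(x_1,\ldots,x_k)^2\prod_{i=1}^k x_i^{n-k}(1-x_i)^{n-k}.$$
   Context: For positive integers $m,n$, $\mathcal{Y}_{m,n}$ is the set of $mn$-tuples $(Y_{i,j})_{1\le i\le m,\,1\le j\le n}$ of reals in $[0,1]$ satisfying, for all $i,j$, $Y_{i,j}<\min(Y_{i,j+1},Y_{i+1,j})$ (inequalities involving indices outside the rectangle are omitted). A uniform random variable on $\mathcal{Y}_{m,n}$ is one distributed according to normalized Lebesgue measure of $\mathbb{R}^{mn}$ restricted to $\mathcal{Y}_{m,n}$. The Vandermonde is $\Delta(x_1,\ldots,x_k)=\prod_{1\le i<j\le k}(x_i-x_j)$ (equal to $1$ for $k=1$). Densities are with respect to Lebesgue measure. *)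

(* Defs.v *)
From HB Require Import structures.
From mathcomp Require Import all_boot all_order all_algebra.
From mathcomp Require Import all_classical all_reals all_analysis.

Set Implicit Arguments.
Unset Strict Implicit.
Unset Printing Implicit Defensive.

Import Order.TTheory GRing.Theory Num.Theory.
Import numFieldNormedType.Exports.

Local Open Scope classical_set_scope.
Local Open Scope ring_scope.

(* R^k, with the product of the Borel sigma-algebras. *)
Notation Rvec R k := (k.-tuple (measurableTypeR R)).

Section sigma_finite_measure_of.
Context d (T : measurableType d) (R : realType) (m : set T -> \bar R).
Hypotheses (m0 : m set0 = 0%E) (m_ge0 : forall A, (0 <= m A)%E).
Hypotheses (m_add : semi_sigma_additive m) (m_fin : sigma_finite setT m).

Local Definition sfm := m.
HB.instance Definition _ := isMeasure.Build _ _ _ sfm m0 m_ge0 m_add.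
HB.instance Definition _ := Measure_isSigmaFinite.Build _ _ _ sfm m_fin.

Lemma sigma_finite_measure_of :
  {mu : {sigma_finite_measure set T -> \bar R} | (mu : set T -> \bar R) = m}.
Proof. by exists sfm. Qed.

End sigma_finite_measure_of.

Section lebesgue_vec.
Local Open Scope ereal_scope.
Variable R : realType.

Definition vec_cons k (p : measurableTypeR R * Rvec R k) : Rvec R k.+1 :=
  [the k.+1.-tuple (measurableTypeR R) of p.1 :: p.2].

(* Lebesgue measure of R^k: the unit mass on the one-point space R^0, then
   iterated products of the one-dimensional Lebesgue measure, transported along
   R * R^k = R^(k+1). It is a sigma-finite measure (instance below) and has the
   expected value on boxes ([lebesgue_vec_box]). *)
Fixpoint lebesgue_vec (k : nat) : set (Rvec R k) -> \bar R :=
  if k is k'.+1 then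
    pushforward (@lebesgue_measure R \x lebesgue_vec (k := k')) (@vec_cons k')
  else \d_([tuple] : Rvec R 0).

Lemma measurable_vec_cons k : measurable_fun setT (@vec_cons k).
Proof. exact: measurable_cons. Qed.

Let vec_uncons k (t : Rvec R k.+1) : measurableTypeR R * Rvec R k :=
  (thead t, [tuple of behead t]).

Let measurable_vec_uncons k : measurable_fun setT (@vec_uncons k).
Proof.
apply/measurable_fun_pairP; split => /=.
  exact: measurable_tnth.
exact: measurable_behead.
Qed.

Let vec_consK k : cancel (@vec_cons k) (@vec_uncons k).
Proof.
move=> [x t]; rewrite /vec_uncons /thead tnth0; congr pair.
exact: val_inj.
Qed.

Let push_measure k (mu : {sigma_finite_measure set (Rvec R k) -> \bar R}) :
  {nu : {measure set (Rvec R k.+1) -> \bar R} |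
    (nu : set _ -> _) = pushforward (@lebesgue_measure R \x mu) (@vec_cons k)}.
Proof.
pose pm : {measure set _ -> \bar R} := @lebesgue_measure R \x mu.
by exists (@measure_function_pushforward__canonical__measure_function_Measure
     _ _ _ _ _ pm _ (@measurable_vec_cons k)).
Qed.

Let push_sigma_finite k
    (mu : {sigma_finite_measure set (Rvec R k) -> \bar R}) :
  sigma_finite setT (pushforward (@lebesgue_measure R \x mu) (@vec_cons k)).
Proof.
have /sigma_finiteP[F [TF ndF Foo]] := sigma_finiteT (@lebesgue_measure R).
have /sigma_finiteP[G [TG ndG Goo]] := sigma_finiteT mu.
exists (fun n => @vec_uncons k @^-1` (F n `*` G n)).
  rewrite -preimage_bigcup (_ : \bigcup_n _ = setT) ?preimage_setT//.
  apply/seteqP; split => // -[x y] _.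
  have [n _ Fnx] : (\bigcup_n F n) x by rewrite -TF.
  have [m _ Gmy] : (\bigcup_n G n) y by rewrite -TG.
  exists (maxn n m) => //; split => /=.
    by move: x Fnx; exact/subsetPset/ndF/leq_maxl.
  by move: y Gmy; exact/subsetPset/ndG/leq_maxr.
move=> n; have [mF Fn] := Foo n; have [mG Gn] := Goo n; split.
  by rewrite -[X in measurable X]setTI; apply: measurable_vec_uncons => //;
    exact: measurableX.
rewrite /pushforward (_ : _ @^-1` _ = F n `*` G n).
  by rewrite product_measure1E// lte_mul_pinfty// ge0_fin_numE.
by apply/seteqP; split => p; rewrite /preimage /mkset vec_consK.
Qed.

Let lebesgue_vec_axioms k : [/\ @lebesgue_vec k set0 = 0,
  forall A, 0 <= @lebesgue_vec k A, semi_sigma_additive (@lebesgue_vec k)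
  & sigma_finite setT (@lebesgue_vec k)].
Proof.
elim: k => [|k [mu0 mu_ge0 mu_add mu_fin]] /=.
  split; [exact: measure0|by move=> A; exact: measure_ge0|
          exact: measure_semi_sigma_additive|exact: sigma_finiteT].
have [mu muE] := sigma_finite_measure_of mu0 mu_ge0 mu_add mu_fin.
rewrite -muE.
have fin := push_sigma_finite mu.
have [nu nuE] := push_measure mu.
rewrite -[pushforward _ _]nuE; split.
- exact: measure0.
- by move=> A; exact: measure_ge0.
- exact: measure_semi_sigma_additive.
- by rewrite nuE.
Qed.

Let lebesgue_vec0 k : @lebesgue_vec k set0 = 0.
Proof. by have [] := lebesgue_vec_axioms k. Qed.

Let lebesgue_vec_ge0 k A : 0 <= @lebesgue_vec k A.
Proof. by have [] := lebesgue_vec_axioms k. Qed.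

Let lebesgue_vec_sigma_additive k : semi_sigma_additive (@lebesgue_vec k).
Proof. by have [] := lebesgue_vec_axioms k. Qed.

HB.instance Definition _ k := isMeasure.Build _ _ _ (@lebesgue_vec k)
  (@lebesgue_vec0 k) (@lebesgue_vec_ge0 k) (@lebesgue_vec_sigma_additive k).

Let lebesgue_vec_sigma_finite k : sigma_finite setT (@lebesgue_vec k).
Proof. by have [] := lebesgue_vec_axioms k. Qed.

HB.instance Definition _ k := Measure_isSigmaFinite.Build _ _ _
  (@lebesgue_vec k) (@lebesgue_vec_sigma_finite k).

Lemma lebesgue_vec_box k (A : 'I_k -> set (measurableTypeR R)) :
  (forall i, measurable (A i)) ->
  @lebesgue_vec k [set x | forall i, A i (tnth x i)]
    = \prod_(i < k) @lebesgue_measure R (A i).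
Proof.
elim: k A => [|k IH] A mA.
  rewrite big_ord0 /= diracE mem_set//=; by case.
rewrite big_ord_recl -IH// /= /pushforward.
rewrite -product_measure1E//; last first.
  rewrite (_ : mkset _ = \bigcap_(i in [set: 'I_k])
      ((fun x : Rvec R k => tnth x i) @^-1` A (lift ord0 i))).
    apply: fin_bigcap_measurable => // i _; rewrite -[X in measurable X]setTI.
    exact: measurable_tnth.
  by apply/seteqP; split => x /= Ax i; [move=> _|]; exact: Ax.
congr ((_ \x _) _); apply/seteqP; split => -[x t] /=.
  move=> Ax; split; first exact: (Ax ord0).
  by move=> i; have := Ax (lift ord0 i); rewrite tnthS.
move=> [Ax At] i; have [j ->|->] := unliftP ord0 i; last exact: Ax.
by rewrite tnthS; exact: At.
Qed.

End lebesgue_vec.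

(* The quotient is taken in [\bar R], so a probability [nu] can only satisfy this
   when [mu S] is positive and finite. *)
Definition uniform_on d (T : measurableType d) (R : realType)
    (mu : set T -> \bar R) (S : set T) (nu : set T -> \bar R) :=
  forall A, measurable A -> nu A = (mu (A `&` S) / mu S)%E.

(* In particular [nu] gives no mass to the complement of [D]. *)
Definition has_density_on d (T : measurableType d) (R : realType)
    (mu : set T -> \bar R) (D : set T) (f : T -> R) (nu : set T -> \bar R) :=
  [/\ measurable_fun D f, (forall x, D x -> 0 <= f x)
    & forall A, measurable A -> nu A = (\int[mu]_(x in A `&` D) (f x)%:E)%E].

Definition unit_cube (R : realType) k : set (Rvec R k) :=
  [set x | forall i, 0 <= (tnth x i : R) <= 1].

(* Points of R^(mn) are flat tuples, indexed by pairs through [mxvec_index]. *)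
Definition entry (R : realType) m n (y : (m * n).-tuple R) (i : 'I_m)
    (j : 'I_n) : R := tnth y (mxvec_index i j).

Definition Yset (R : realType) m n : set (Rvec R (m * n)) :=
  [set y | forall (i : 'I_m) (j : 'I_n),
    [/\ 0 <= entry y i j <= 1,
        forall j' : 'I_n, j' = j.+1 :> nat -> entry y i j < entry y i j'
      & forall i' : 'I_m, i' = i.+1 :> nat -> entry y i j < entry y i' j]].

(* 0-based: coordinate [i] of the k-tuple is the entry (i, n - k + i). *)
Definition diag_tuple (R : realType) n k (kn : (k <= n)%N)
    (y : (n * n).-tuple R) : k.-tuple R :=
  [tuple entry y (widen_ord kn i) (cast_ord (subnK kn) (rshift (n - k) i))
     | i < k].

Definition vandermonde (R : realType) k (x : k.-tuple R) : R :=
  \prod_(i < k) \prod_(j < k | (i < j)%N) (tnth x i - tnth x j).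

Definition diagonal_weight (R : realType) n k (x : k.-tuple R) : R :=
  (sorted <=%R x)%:R * vandermonde x ^+ 2 *
  \prod_(i < k) (tnth x i ^+ (n - k) * (1 - tnth x i) ^+ (n - k)).

Arguments unit_cube : clear implicits.
Arguments Yset : clear implicits.

(* Main.v *)
(* Slice the array along its diagonals [j - i = const]. Two consecutive diagonals
   only interact through interlacing inequalities, so the volume of the set of
   arrays with a prescribed k-tuple x on the chosen diagonal factors into the
   volumes above and below it, each an iterated integral over diagonals.
   Integrating the Vandermonde determinant of a vector y interlaced with x
   ([x_i < y_i < x_(i+1)]) returns, row by row, a multiple of the Vandermonde
   determinant of x. While the diagonals get shorter towards x, the end slots are
   bounded by 0 and 1, and the integral is a case of the Dixon-Anderson integral:
   integrating [prod (y_i (1 - y_i))^s * Delta y] gives a multiple of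
   [prod (x_i (1 - x_i))^(s+1) * Delta x]. Multiplying the contributions of both
   sides yields [Delta x ^ 2 * prod (x_i (1 - x_i))^(n-k)]. *)
Require Import Defs.
From HB Require Import structures.
From mathcomp Require Import all_boot all_order all_algebra.
From mathcomp Require Import all_classical all_reals all_analysis.
From mathcomp Require Import measurable_realfun zify ring.

Import Order.TTheory GRing.Theory Num.Theory.
Import numFieldNormedType.Exports.

Local Open Scope classical_set_scope.
Local Open Scope ring_scope.

(** * Iterated integrals *)

Section Marginal.
Context {R : realType} {T : eqType}.
Implicit Types (f g : (T -> R) -> \bar R) (z : T -> R) (s : seq T).
Local Open Scope ereal_scope.

Definition update z (i : T) (u : R) : T -> R :=
  fun j => if j == i then u else z j.

(** Points are functions on [T] rather than tuples, so coordinates can be integrated in any order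
    without reindexing. The head of [s] is the outermost integral. *)
Fixpoint marginal s f z : \bar R :=
  if s is i :: s' then
    \int[@lebesgue_measure R]_u marginal s' f (update z i u)
  else f z.

(* Measurability for the product sigma-algebra on [T -> R], tested on families of
   points with measurable coordinates. *)
Definition coord_measurable f :=
  forall d (X : measurableType d) (c : X -> T -> measurableTypeR R),
    (forall i, measurable_fun setT (c ^~ i)) ->
    measurable_fun setT (f \o c).

Lemma update_same z i u : update z i u i = u.
Proof. by rewrite /update eqxx. Qed.

Lemma update_neq z i u j : j != i -> update z i u j = z j.
Proof. by rewrite /update => /negbTE ->. Qed.

Lemma update_comm z i j u v : i != j ->
  update (update z i u) j v = update (update z j v) i u.
Proof.
move=> ij; apply/funext => k; rewrite /update.
by case: eqP => [->|//]; rewrite eq_sym (negbTE ij).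
Qed.

Lemma marginal_ge0 s f z : (forall z, 0 <= f z) -> 0 <= marginal s f z.
Proof.
by move=> f0; elim: s z => //= i s IH z; apply: integral_ge0 => u _; exact: IH.
Qed.

Lemma marginal_0 s z : marginal s (fun=> 0) z = 0.
Proof. by elim: s z => //= i s IH z; apply: integral0_eq => u _; exact: IH. Qed.

Lemma marginal_cat s1 s2 f z :
  marginal (s1 ++ s2) f z = marginal s1 (marginal s2 f) z.
Proof. by elim: s1 z => //= i s IH z; apply: eq_integral => u _; exact: IH. Qed.

(** Only points that agree with [z] off [s] are visited, so a factor reading no coordinate in [s]
    may be evaluated at [z]. *)
Lemma eq_marginal s f g z :
  (forall y, {in [predC s], y =1 z} -> f y = g y) ->
  marginal s f z = marginal s g z.
Proof.
elim: s z => [|i s IH] z fg /=; first exact: fg.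
apply: eq_integral => u _; apply: IH => y yz; apply: fg => j.
rewrite !inE negb_or => /andP[ji js].
by rewrite yz ?inE// update_neq.
Qed.

Lemma measurable_update d (X : measurableType d)
    (c : X -> T -> measurableTypeR R) i :
  (forall j, measurable_fun setT (c ^~ j)) ->
  forall j, measurable_fun setT
    (fun p : X * measurableTypeR R => update (c p.1) i p.2 j : measurableTypeR R).
Proof.
move=> mc j; rewrite /update; case: eqP => [_|_]; first exact: measurable_snd.
exact: measurableT_comp (mc j) measurable_fst.
Qed.

(** Because [coord_measurable] quantifies over every parameter space [X], the induction can add the
    variable being integrated to the parameters and apply Tonelli on the product of [X] with the
    line. *)
Lemma coord_measurable_marginal s f : (forall z, 0 <= f z) ->
  coord_measurable f -> coord_measurable (marginal s f).
Proof.
move=> f0 mf; elim: s => //= i s IH d X c mc.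
pose F (p : X * measurableTypeR R) := marginal s f (update (c p.1) i p.2).
apply: (measurable_fun_fubini_tonelli_F (m2 := @lebesgue_measure R) F).
  exact: IH (measurable_update _ _ _ _ mc).
by move=> p; exact: marginal_ge0.
Qed.

Lemma marginal_swap i j f z : (forall z, 0 <= f z) -> coord_measurable f ->
  marginal [:: i; j] f z = marginal [:: j; i] f z.
Proof.
move=> f0 mf; have [->//|ij] := eqVneq i j.
pose F (p : measurableTypeR R * measurableTypeR R) :=
  f (update (update z i p.1) j p.2).
rewrite /= (fubini_tonelli (m1 := @lebesgue_measure R)
  (m2 := @lebesgue_measure R) F) => [|//|]; last 2 first.
- apply: mf; apply: (@measurable_update _ _ (fun u => update z i u)) => k.
  rewrite /update; case: (k == i); last exact: measurable_cst.
  exact: measurable_id.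
- by move=> p; exact: f0.
apply: eq_integral => u _; apply: eq_integral => v _.
by rewrite /F /= update_comm.
Qed.

Lemma marginal_front i s1 s2 f z :
  (forall z, 0 <= f z) -> coord_measurable f ->
  marginal (s1 ++ i :: s2) f z = marginal (i :: s1 ++ s2) f z.
Proof.
move=> f0 mf; elim: s1 z => // j s1 IH z.
transitivity (marginal ([:: j; i] ++ (s1 ++ s2)) f z).
  by apply: eq_integral => u _; exact: IH.
rewrite -[RHS]/(marginal ([:: i; j] ++ (s1 ++ s2)) f z) 2!marginal_cat.
apply: marginal_swap.
  by move=> y; exact: marginal_ge0.
exact: coord_measurable_marginal.
Qed.

(** Tonelli for an arbitrary reordering, built from adjacent swaps. It turns the order of the flat
    tuple into an order by diagonals. *)
Lemma perm_marginal s1 s2 f z : (forall z, 0 <= f z) -> coord_measurable f ->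
  perm_eq s1 s2 -> marginal s1 f z = marginal s2 f z.
Proof.
move=> f0 mf; elim: s1 s2 z => [|i s1 IH] s2 z.
  by rewrite perm_sym => /perm_nilP ->.
move=> s12; have /(nthP i)[m ms2 im] : i \in s2.
  by rewrite -(perm_mem s12) mem_head.
have s2E : s2 = take m s2 ++ i :: drop m.+1 s2.
  by rewrite -[LHS](cat_take_drop m) (drop_nth i)// im.
rewrite s2E marginal_front//=; apply: eq_integral => u _; apply: IH.
by rewrite -(perm_cons i) (permPl s12) {1}s2E (perm_catCA _ [:: i]).
Qed.

Definition coords k (h : 'I_k -> T) z : Rvec R k := [tuple z (h i) | i < k].

Lemma measurable_coords k (h : 'I_k -> T) d (X : measurableType d)
    (c : X -> T -> measurableTypeR R) :
  (forall i, measurable_fun setT (c ^~ i)) ->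
  measurable_fun setT (fun x => coords k h (c x)).
Proof.
move=> mc; apply/measurable_fun_tnthP => i.
rewrite (_ : _ \o _ = c ^~ (h i))//.
by apply/funext => x /=; rewrite tnth_mktuple.
Qed.

(** The base point [z] is arbitrary: the integrand reads only coordinates in the image of [h], and
    all of these are integrated. *)
Lemma integral_lebesgue_vec k (h : 'I_k -> T) (g : Rvec R k -> \bar R) z :
  injective h -> (forall t, 0 <= g t) -> measurable_fun setT g ->
  \int[@lebesgue_vec R k]_t g t
    = marginal [seq h i | i <- enum 'I_k] (g \o coords k h) z.
Proof.
elim: k h g z => [|k IH] h g z hinj g0 mg.
  rewrite enum_ord0 /= integral_dirac// diracT mul1e; congr g.
  by apply: eq_from_tnth => -[].
rewrite enum_ordSl /= ge0_integral_pushforward//; last exact: measurable_vec_cons.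
rewrite preimage_setT fubini_tonelli1//=; last first.
  exact: measurableT_comp mg (@measurable_vec_cons R k).
apply: eq_integral => u _.
rewrite /fubini_F (IH (h \o lift ord0) _ (update z (h ord0) u)) => [||t|];
  last 3 first.
- by move=> i j /hinj/lift_inj.
- exact: g0.
- apply: measurableT_comp mg _.
  apply: measurableT_comp (@measurable_vec_cons R k) _.
  exact: measurable_pair1.
rewrite -map_comp; apply: eq_marginal => y yz /=; congr g.
apply: eq_from_tnth => i; rewrite tnth_mktuple.
have [j ->|->] := unliftP ord0 i.
  by rewrite tnthS tnth_mktuple.
rewrite tnth0 yz ?update_same// inE; apply/mapP => -[j _ /hinj].
by move/eqP; rewrite (negbTE (neq_lift _ _)).
Qed.

End Marginal.

(** * Determinants *)

Section Determinants.
Context {R : comUnitRingType}.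
Implicit Types (F : nat -> nat -> R) (c d : nat -> R).

Lemma det_scale l F c d :
  \det (\matrix_(i < l, j < l) (c i * F i j * d j))
    = (\prod_(i < l) c i) * \det (\matrix_(i < l, j < l) F i j)
      * \prod_(j < l) d j.
Proof.
rewrite (_ : \matrix_(i, j) _ = diag_mx (\row_(i < l) c i)
    *m \matrix_(i < l, j < l) F i j *m diag_mx (\row_(i < l) d i)).
  rewrite !det_mulmx !det_diag; congr (_ * _ * _);
    by apply: eq_bigr => i _; rewrite mxE.
by apply/matrixP => i j; rewrite mul_mx_diag mul_diag_mx !mxE.
Qed.

Lemma det_row_differences l F :
  \det (\matrix_(i < l.+1, j < l.+1)
          (F i j - (if i : nat is i'.+1 then F i' j else 0)))
    = \det (\matrix_(i < l.+1, j < l.+1) F i j).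
Proof.
(* Left multiplication by the unitriangular matrix [L] subtracts from each row the one above it. *)
pose L : 'M[R]_l.+1 := \matrix_(i, k) ((i == k)%:R - (i == k.+1 :> nat)%:R).
have detL : \det L = 1.
  rewrite det_trig; last first.
    apply/is_trig_mxP => i j ij; rewrite mxE (ltn_eqF (ltnW ij : (i < j.+1)%N)).
    by rewrite -val_eqE/= (ltn_eqF ij) subr0.
  by rewrite big1// => i _; rewrite mxE eqxx (ltn_eqF (ltnSn i)) subr0.
rewrite -[RHS]mul1r -detL -det_mulmx; congr (\det _).
apply/matrixP => i j; rewrite !mxE.
under eq_bigr do rewrite !mxE mulrBl.
rewrite sumrB; congr (_ - _).
  rewrite (bigD1 i)//= eqxx mul1r big1 ?addr0// => k ki.
  by rewrite eq_sym (negbTE ki) mul0r.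
case: i => -[|i] /= il; first by rewrite big1// => k _; rewrite mul0r.
rewrite (bigD1 (Ordinal (ltnW il)))//= eqxx mul1r big1 ?addr0// => k.
by rewrite -val_eqE/= eqSS eq_sym => /negbTE ->; rewrite mul0r.
Qed.

(** Row differences reduce the constant column of the Vandermonde matrix to its top entry 1;
    expanding along that column leaves the minor of differences. *)
Lemma det_powers_differences l c :
  \det (\matrix_(i < l, j < l) (c i.+1 ^+ j.+1 - c i ^+ j.+1))
    = \det (\matrix_(i < l.+1, j < l.+1) c i ^+ j).
Proof.
rewrite -(det_row_differences l (fun i j => c i ^+ j)) (expand_det_col _ ord0).
rewrite (bigD1 ord0)//= big1 ?addr0 => [|[[|i] il]//]; last first.
  by move=> _; rewrite !mxE/= !expr0 subrr mul0r.
rewrite mxE/= expr0 subr0 mul1r /cofactor addn0 expr0 mul1r.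
by congr (\det _); apply/matrixP => i j; rewrite !mxE.
Qed.

(** Consecutive differences are the row differences of [F i.+1 j - F 0 j]. In that matrix the last
    row vanishes outside column 0, by the hypothesis, and expanding along it produces the sign. *)
Lemma det_differences_boundary l F :
  (forall j, (j < l)%N -> F l.+1 j.+1 = F 0 j.+1) ->
  \det (\matrix_(i < l.+1, j < l.+1) (F i.+1 j - F i j))
    = (-1) ^+ l * (F l.+1 0 - F 0 0)
      * \det (\matrix_(i < l, j < l) (F i.+1 j.+1 - F 0 j.+1)).
Proof.
move=> FE; transitivity (\det (\matrix_(i < l.+1, j < l.+1) (F i.+1 j - F 0 j))).
  rewrite -(det_row_differences l (fun i j => F i.+1 j - F 0 j)); congr (\det _).
  apply/matrixP => -[[|i] il] j; rewrite !mxE/= ?subr0//.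
  by rewrite opprB addrA subrK.
rewrite (expand_det_row _ ord_max) (bigD1 ord0)//= big1 ?addr0; last first.
  by move=> [[|j] jl]// _; rewrite !mxE/= FE// subrr mul0r.
rewrite !mxE/= /cofactor /= addn0 mulrCA mulrA; congr (_ * \det _).
by apply/matrixP => i j; rewrite !mxE/= /bump leqNgt ltn_ord.
Qed.

(** The change of basis from monomials to [psi] is unitriangular. *)
Lemma det_monic l (psi : nat -> {poly R}) c :
  (forall j, psi j \is monic) -> (forall j, size (psi j) = j.+1) ->
  \det (\matrix_(i < l, j < l) (psi j).[c i])
    = \det (\matrix_(i < l, j < l) c i ^+ j).
Proof.
move=> psi_monic psi_size.
pose U : 'M[R]_l := \matrix_(k, j) (psi j)`_k.
have detU : \det U = 1.
  rewrite -det_tr det_trig; last first.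
    by apply/is_trig_mxP => i j ij; rewrite !mxE nth_default// psi_size.
  rewrite big1// => i _; rewrite !mxE.
  by have /monicP := psi_monic i; rewrite /lead_coef psi_size.
rewrite -[RHS]mulr1 -detU -det_mulmx; congr (\det _).
apply/matrixP => i j; rewrite !mxE (@horner_coef_wide _ l) ?psi_size//.
by apply: eq_bigr => k _; rewrite !mxE mulrC.
Qed.

End Determinants.

(** * Integrals over interlacing boxes *)

Lemma ex_poly_primitive (R : numFieldType) (p : {poly R}) :
  exists P : {poly R}, P^`() = p.
Proof.
(* At [i = 0] the coefficient is a quotient by zero, hence 0; it is the constant term, which
   differentiation erases. *)
exists (\poly_(i < (size p).+1) (p`_i.-1 / i%:R)).
apply/polyP => i; rewrite coef_deriv coef_poly ltnS.
have [ip|pi] := ltnP i (size p); last by rewrite mul0rn nth_default.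
by rewrite /= -[LHS]mulr_natr divfK// pnatr_eq0.
Qed.

(** Up to powers of X and 1 - X, the derivative of the product is linear with leading coefficient
    -r; the scalar [- r^-1] makes the cofactor of the beta weight monic. *)
Lemma deriv_beta_poly (F : numFieldType) (s j : nat)
    (r := (s.+1 + j + s.+1)%:R : F) :
  (- r^-1 *: ('X^(s.+1 + j) * (1 - 'X) ^+ s.+1))^`() =
  'X^s * (1 - 'X) ^+ s * ('X^j * ('X - ((s.+1 + j)%:R / r)%:P)).
Proof.
have rV : r^-1%:P * ((s.+1 + j)%:R + s.+1%:R) = 1 :> {poly F}.
  by rewrite -natrD -polyC_natr -polyCM mulVf// pnatr_eq0 !addSn.
rewrite derivZ derivM derivXn deriv_exp derivB derivX derivC sub0r.
rewrite polyCM polyC_natr -mul_polyC polyCN.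
move: rV; rewrite addSn !succnK.
rewrite -(mulr_natr 'X^(s + j)) -(mulr_natr (-1 * _)) 2!exprS !exprD.
move: ((s + j).+1%:R : {poly F}) (s.+1%:R : {poly F}) (r^-1)%:P => N M ri rV.
move: ('X^s : {poly F}) ('X^j : {poly F}) ((1 - 'X) ^+ s : {poly F}) => Y U Z.
apply/eqP; rewrite -subr_eq0; apply/eqP.
(* The two sides differ by a multiple of the relation [rV]. *)
transitivity (Y * U * Z * 'X * (ri * (N + M) - 1)); first by ring.
by rewrite rV subrr mulr0.
Qed.

Section BoxIntegral.
Context {R : realType}.

Lemma integral_itv_horner (p P : {poly R}) (a b : R) (ba bb : bool) :
  a <= b -> P^`() = p ->
  (\int[@lebesgue_measure R]_(u in [set` Interval (BSide ba a) (BSide bb b)])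
    (p.[u])%:E = (P.[b] - P.[a])%:E)%E.
Proof.
move=> ab Pp; rewrite (@integral_itv_bndoo _ _ _ (fun u => (p.[u])%:E));
  last by apply/measurable_EFinP; exact: measurable_poly.
move: ab; rewrite le_eqVlt => /predU1P[->|ab].
  by rewrite set_itvoo0 integral_set0 subrr.
rewrite -(@integral_itv_bndoo _ a b (fun u => (p.[u])%:E) true false);
  last by apply/measurable_EFinP; exact: measurable_poly.
rewrite (@continuous_FTC2 _ (horner p) (horner P))//.
- exact/continuous_subspaceT/continuous_horner.
- split.
  + by move=> x _; exact: derivable_horner.
  + exact/cvg_at_right_filter/continuous_horner.
  + exact/cvg_at_left_filter/continuous_horner.
- by move=> x _; rewrite -derivE Pp.
Qed.

Variables (T : eqType) (q : nat -> T) (l : nat).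
Hypothesis q_inj : {in [pred i | (i < l)%N] &, injective q}.
Variables (ba bb : nat -> bool) (a b : nat -> R) (phi Phi : nat -> {poly R}).
Hypothesis Phi_deriv : forall j, (Phi j)^`() = phi j.

Let I i := Interval (BSide (ba i) (a i)) (BSide (bb i) (b i)).

(** Interpolates between the integrand ([m = l]) and the integrated determinant ([m = 0]): rows from
    [m] on have already been integrated. *)
Let M m (y : T -> R) : 'M[R]_l := \matrix_(i < l, j < l)
  if (i < m)%N then (phi j).[y (q i)] else (Phi j).[b i] - (Phi j).[a i].

Let G kappa m y := kappa * \prod_(i < m) (y (q i) \in I i)%:R * \det (M m y).

(* The determinant is affine in each row, so the variables can be integrated out
   one at a time, each replacing its row by the increments of the primitives. *)
Let marginal_partial kappa m z : (m <= l)%N ->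
  (forall i, (i < m)%N -> a i <= b i) ->
  marginal [seq q i | i <- iota 0 m] (fun y => (G kappa m y)%:E) z
    = (G kappa 0 z)%:E.
Proof.
elim: m z => [//|m IH] z ml ab.
(* The list is peeled from its end, since the last variable carries the innermost integral. *)
rewrite -addn1 iotaD map_cat marginal_cat add0n addn1 -[RHS]IH; last 2 first.
- exact: ltnW.
- by move=> i im; apply: ab; rewrite ltnS ltnW.
congr marginal; apply/funext => y /=.
pose m' : 'I_l := Ordinal ml.
(* The cofactors of row [m] do not see that row, so they are constants while [y (q m)] varies, and
   the integrand is the polynomial [p] in this variable times an indicator. *)
pose cof j := cofactor (M m y) m' j.
pose p := (kappa * \prod_(i < m) (y (q i) \in I i)%:R) *:
  \sum_(j < l) cof j *: phi j.
pose P := (kappa * \prod_(i < m) (y (q i) \in I i)%:R) *: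
  \sum_(j < l) cof j *: Phi j.
have Pp : P^`() = p.
  rewrite derivZ; congr (_ *: _); rewrite raddf_sum/=.
  by apply: eq_bigr => j _; rewrite derivZ Phi_deriv.
have updE u i : (i < m)%N -> update y (q m) u (q i) = y (q i).
  move=> im; rewrite update_neq//; apply/eqP => /q_inj qi.
  by move: (im); rewrite qi ?inE ?ltnn// (ltn_trans im).
have GE u : G kappa m.+1 (update y (q m) u) = (u \in I m)%:R * p.[u].
  rewrite /G big_ord_recr/= update_same hornerZ horner_sum.
  under eq_bigr => i _ do rewrite updE//.
  rewrite (expand_det_row _ m') mulrA mulrAC mulrC -!mulrA; congr (_ * _).
  rewrite mulrA [RHS]mulrA [LHS]mulrC [RHS]mulrC; congr (_ * _).
  apply: eq_bigr => j _; rewrite hornerZ [RHS]mulrC; congr (_ * _).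
    by rewrite mxE /= ltnSn update_same.
  rewrite /cof /cofactor; congr (_ * \det _); apply/matrixP => i i'; rewrite !mxE.
  have := neq_lift m' i; rewrite -val_eqE/= neq_ltn => /orP[mi|im].
    by rewrite ltnS leqNgt mi /= ltnNge ltnW.
  by rewrite im ltnS (ltnW im) updE.
under eq_integral do rewrite GE.
rewrite (_ : (fun _ => _) = (fun u => (p.[u])%:E) \_ [set` I m]); last first.
  apply/funext => u; rewrite patchE mem_setE; case: (u \in I m).
    by rewrite mul1r.
  by rewrite mul0r.
rewrite -integral_mkcond (integral_itv_horner _ _ _ _ _ _ _ Pp); last exact: ab.
rewrite /G !hornerZ -mulrBr -/p !horner_sum -sumrB (expand_det_row _ m').
congr (_ * _)%:E; apply: eq_bigr => j _.
by rewrite !hornerZ -mulrBr mulrC /M mxE ltnn.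
Qed.

(** The test on the bounds records that a box with a reversed side is empty, whereas the increments
    of the primitives alone would give a signed value. *)
Lemma marginal_det_box kappa z :
  marginal [seq q i | i <- iota 0 l]
    (fun y => (kappa * \prod_(i < l) (y (q i) \in I i)%:R
       * \det (\matrix_(i < l, j < l) (phi j).[y (q i)]))%:E) z
  = (kappa * [forall i : 'I_l, a i <= b i]%:R
     * \det (\matrix_(i < l, j < l) ((Phi j).[b i] - (Phi j).[a i])))%:E.
Proof.
have [/forallP ab|/forallPn[i0 ba0]] := boolP [forall i : 'I_l, a i <= b i].
  transitivity (marginal [seq q i | i <- iota 0 l]
      (fun y => (G kappa l y)%:E) z).
    congr marginal; apply/funext => y; rewrite /G; congr (_ * \det _)%:E.
    by apply/matrixP => i j; rewrite !mxE ltn_ord.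
  rewrite marginal_partial//; last by move=> i il; exact: (ab (Ordinal il)).
  by rewrite /G big_ord0; congr (_ * \det _)%:E.
rewrite mulr0 mul0r (_ : (fun y => _) = fun=> 0%:E); first exact: marginal_0.
apply/funext => y.
rewrite (bigD1 i0)//= (_ : _ \in _ = false) ?mul0r ?mulr0 ?mul0r//.
rewrite in_itv/=; apply/negbTE; apply: contra ba0 => /andP[ay yb].
by move: (ba i0) (bb i0) ay yb => [] [] /= ay yb;
  apply: le_trans (_ : y (q i0) <= _) => //; exact: ltW.
Qed.

End BoxIntegral.

(** * Vandermonde determinants integrated over interlacing points *)

Section Interlacing.
Context {R : realType} {T : eqType}.

(** The box integral for monomials: the primitives contribute the column factors 1/(j+1), and the
    remaining determinant of differences of powers is a Vandermonde determinant one size larger. *)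
Lemma marginal_interlacing l (q : nat -> T) (x : nat -> R) kappa z :
  {in [pred i | (i < l)%N] &, injective q} ->
  marginal [seq q i | i <- iota 0 l]
    (fun y => (kappa * \prod_(i < l) (x i < y (q i) < x i.+1)%R%:R
       * \det (\matrix_(i < l, j < l) (y (q i) ^+ j)))%:E) z
  = (kappa * (sorted <=%R (mkseq x l.+1))%:R
     * ((\prod_(j < l) j.+1%:R^-1)
        * \det (\matrix_(i < l.+1, j < l.+1) (x i ^+ j))))%:E.
Proof.
move=> q_inj.
pose Phi j : {poly R} := j.+1%:R^-1 *: 'X^(j.+1).
have PhiP j : (Phi j)^`() = 'X^j.
  rewrite derivZ derivXn /= -(scaler_nat _ 'X^j) scalerA.
  by rewrite mulVf ?scale1r// pnatr_eq0.
have := @marginal_det_box R T q l q_inj xpred0 xpredT x (fun i => x i.+1) _ _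
  PhiP kappa z.
under eq_marginal.
  move=> y _.
  rewrite (_ : \matrix_(_, _) _ = \matrix_(i < l, j < l) (y (q i) ^+ j));
    last first.
    by apply/matrixP => i j; rewrite !mxE hornerXn.
  over.
move=> ->; rewrite -mulrA -[in RHS]mulrA; congr (_ * _)%:E.
rewrite -det_powers_differences.
congr (_ * _).
  congr (_%:R : R); congr nat_of_bool.
  apply/forallP/(sortedP 0) => [ab i|sx i].
    rewrite size_mkseq ltnS => il; rewrite !nth_mkseq// ?ltnS 1?ltnW//.
    exact: (ab (Ordinal il)).
  have := sx i; rewrite size_mkseq ltnS ltn_ord !nth_mkseq ?ltnS//; first exact.
  by rewrite ltnW.
have := det_scale l (fun i j => x i.+1 ^+ j.+1 - x i ^+ j.+1) (fun=> 1)
  (fun j => j.+1%:R^-1).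
rewrite big1_eq mul1r [X in _ = X]mulrC => <-.
congr (\det _); apply/matrixP => i j; rewrite !mxE !hornerE.
by rewrite -mulrBr mulrC.
Qed.

Definition endpoint l (x : nat -> R) i : R :=
  if i is i'.+1 then if (i' < l)%N then x i' else 1 else 0.

(* The i-th of the l+1 intervals cut out of [0, 1] by the l points of x, open at
   these points and closed at 0 and 1. *)
Definition slot l x i : interval R := Interval
  (BSide (i == 0) (endpoint l x i)) (BSide (i != l) (endpoint l x i.+1)).

(* The Dixon-Anderson integral with exponent s at 0 and 1. The determinant is
   rewritten in a monic basis 1, psi_1, psi_2, ... for which psi_(j+1) times the
   weight w is a multiple of the derivative of [X^j (X (1 - X))^(s+1)]: these
   primitives vanish at 0 and 1, so only the first column, whose primitive is the
   incomplete beta function, sees the end points. *)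
Lemma marginal_interlacing01 l s : exists2 C, 0 <= C &
  forall (q : nat -> T) (x : nat -> R) kappa z,
  {in [pred i | (i < l.+1)%N] &, injective q} ->
  (forall i, (i < l)%N -> 0 <= x i <= 1) ->
  marginal [seq q i | i <- iota 0 l.+1]
    (fun y => (kappa * \prod_(i < l.+1) (y (q i) \in slot l x i)%:R
       * ((\prod_(i < l.+1) (y (q i) ^+ s * (1 - y (q i)) ^+ s))
         * \det (\matrix_(i < l.+1, j < l.+1) (y (q i) ^+ j))))%:E) z
  = (kappa * (sorted <=%R (mkseq x l))%:R
     * (C * ((\prod_(i < l) (x i ^+ s.+1 * (1 - x i) ^+ s.+1))
        * \det (\matrix_(i < l, j < l) (x i ^+ j)))))%:E.
Proof.
pose w : {poly R} := 'X^s * (1 - 'X) ^+ s.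
have [B Bw] := ex_poly_primitive _ w.
pose p j : R := (s.+1 + j)%:R.
pose r j : R := (s.+1 + j + s.+1)%:R.
have r0 j : r j != 0 by rewrite pnatr_eq0 !addSn.
pose psi j : {poly R} :=
  if j is j'.+1 then 'X^j' * ('X - (p j' / r j')%:P) else 1.
have psi_monic j : psi j \is monic.
  by case: j => [|j] /=; rewrite ?monic1// monicMl ?monicXsubC ?monicXn.
have psi_size j : size (psi j) = j.+1.
  case: j => [|j] /=; first by rewrite size_poly1.
  by rewrite size_Mmonic ?monicXsubC ?polyXn_eq0 -?size_poly_eq0 ?size_polyXn//
    size_XsubC addn2.
pose Phi j : {poly R} := if j is j'.+1 then
  (- (r j')^-1) *: ('X^(s.+1 + j') * (1 - 'X) ^+ s.+1) else B.
have PhiP j : (Phi j)^`() = w * psi j.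
  case: j => [|j] /=; first by rewrite mulr1.
  exact: deriv_beta_poly.
(* The sign comes from expanding along the last row, the middle factor is the complete beta integral
   of the first column, and the product collects the scalars of the other primitives. The signs
   cancel, so the constant is nonnegative. *)
exists ((-1) ^+ l * (B.[1] - B.[0]) * \prod_(j < l) - (r j)^-1).
  have -> : \prod_(j < l) - (r j)^-1 = (-1) ^+ l * \prod_(j < l) (r j)^-1.
    by rewrite prodrN card_ord.
  rewrite mulrACA -exprMn mulrNN mulr1 expr1n mul1r mulr_ge0//; last first.
    by apply: prodr_ge0 => j _; rewrite invr_ge0 ler0n.
  rewrite -lee_fin -(@integral_itv_horner _ _ _ _ _ true false ler01 Bw).
  apply: integral_ge0 => u /=; rewrite in_itv/= => /andP[u0 u1].
  by rewrite lee_fin /w !hornerE mulr_ge0 ?exprn_ge0 ?subr_ge0.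
move=> q x kappa z q_inj x01.
have := @marginal_det_box R T q _ q_inj (fun i => i == 0)%N (fun i => i != l)
  (endpoint l x) (fun i => endpoint l x i.+1) _ _ PhiP kappa z.
under eq_marginal.
  move=> y _.
  rewrite (_ : \det _ =
      (\prod_(i < l.+1) (y (q i) ^+ s * (1 - y (q i)) ^+ s))
      * \det (\matrix_(i < l.+1, j < l.+1) (y (q i) ^+ j))); last first.
    rewrite -(det_monic l.+1 psi (fun i => y (q i)))//.
    have := det_scale l.+1 (fun i j => (psi j).[y (q i)])
      (fun i => y (q i) ^+ s * (1 - y (q i)) ^+ s) (fun=> 1).
    rewrite big1_eq mulr1 => <-.
    congr (\det _); apply/matrixP => i j; rewrite !mxE mulr1 hornerM.
    congr (_ * _).
    by rewrite /w !hornerE.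
  over.
move=> ->; rewrite -mulrA -[in RHS]mulrA; congr (_ * _)%:E.
congr (_ * _).
  congr (_%:R : R); congr nat_of_bool.
  (* The inner bounds express sortedness of [x]; the outer comparisons with 0 and 1 come from
     [x01]. *)
  apply/forallP/(sortedP 0) => [ab i|sx [[|i] il]]/=.
  - rewrite size_mkseq => il; rewrite !nth_mkseq//; last exact: ltnW.
    by have := ab (Ordinal (ltnW il : i.+1 < l.+1)%N); rewrite /= il (ltnW il).
  - by case: ltnP => // l0; have /andP[] := x01 _ l0.
  - rewrite -ltnS il; case: ltnP => il'; last by have /andP[] := x01 _ il.
    have := sx i; rewrite size_mkseq !nth_mkseq//; exact.
pose F i j := (Phi j).[endpoint l x i].
rewrite (det_differences_boundary l F); last first.
  move=> j jl; rewrite /F/= ltnn !hornerE/= subrr !expr0n addSn /=.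
  by rewrite !mulr0 mul0r.
rewrite {1 2}/F /= ltnn -[RHS]mulrA; congr (_ * _).
have := det_scale l (fun i j => x i ^+ j)
  (fun i => x i ^+ s.+1 * (1 - x i) ^+ s.+1) (fun j => - (r j)^-1).
rewrite [X in _ = X]mulrC => <-; congr (\det _).
apply/matrixP => i j; rewrite !mxE /F /= ltn_ord !hornerE/= expr0n addSn /=.
by rewrite mulr0 mul0r subr0 -addSn exprD; ring.
Qed.

End Interlacing.

(** * Integrating out one diagonal *)

Section Diagonals.
Context {R : realType}.
Variable n : nat.
Implicit Types (z y : nat * nat -> R) (K : (nat * nat -> R) -> R).

(* The diagonal [j - i = a - n], for [0 < a < 2n]; at most one of the truncated
   differences is nonzero. *)
Definition diag_pos a i : nat * nat := (i + (n - a), i + (a - n))%N.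
Definition diag_len a : nat := (n - (a - n) - (n - a))%N.
Definition diag_seq a := [seq diag_pos a i | i <- iota 0 (diag_len a)].
Definition diags s := flatten [seq diag_seq a | a <- s].

(* The constraints of [Yset] between the diagonals a and b. *)
Definition ordered_band a b z : Prop := forall i j, (i < n)%N -> (j < n)%N ->
  (i + a <= n + j)%N -> (n + j <= i + b)%N ->
  [/\ 0 <= z (i, j) <= 1,
      (j.+1 < n)%N -> (n + j < i + b)%N -> z (i, j) < z (i, j.+1)
    & (i.+1 < n)%N -> (i + a < n + j)%N -> z (i, j) < z (i.+1, j)].

(** The profile, up to a constant, that the arrays on one side of a diagonal with entries [x]
    contribute. It carries a single Vandermonde determinant; the square arises from the two
    sides. *)
Definition weight l e (x : nat -> R) : R := (sorted <=%R (mkseq x l))%:R *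
  ((\prod_(i < l) (x i ^+ e * (1 - x i) ^+ e)) *
   \det (\matrix_(i < l, j < l) (x i ^+ j))).

Lemma diag_pos_inj a l : {in [pred i | (i < l)%N] &, injective (diag_pos a)}.
Proof. by move=> i j _ _ []; lia. Qed.

Lemma eq_ordered_band a b z y :
  (forall p, (p.1 + a <= n + p.2 <= p.1 + b)%N -> z p = y p) ->
  ordered_band a b z <-> ordered_band a b y.
Proof.
have half z' y' : (forall p, (p.1 + a <= n + p.2 <= p.1 + b)%N -> z' p = y' p) ->
    ordered_band a b z' -> ordered_band a b y'.
  move=> zy oz i j i_n j_n aij ijb.
  have [zij zr zd] := oz i j i_n j_n aij ijb.
  rewrite -zy/= ?aij//.
  by split=> // h1 h2; rewrite -zy/=; [exact: zr|lia|exact: zd|lia].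
move=> zy; split; apply: half => // p hp; by rewrite zy.
Qed.

(** From the main diagonal to the upper right corner the diagonals shorten. Each entry of the new
    one lies between its left neighbour and the one below it, which also confine it to [0, 1]. *)
Lemma ordered_band_gt a b z : (n <= b)%N -> (b.+1 < n + n)%N -> (a <= b)%N ->
  ordered_band a b.+1 z <-> ordered_band a b z /\
    forall i, (i < diag_len b.+1)%N ->
      z (diag_pos b i) < z (diag_pos b.+1 i) < z (diag_pos b i.+1).
Proof.
rewrite /diag_len /diag_pos => nb b2n ab.
have -> : (n - b = 0)%N by lia.
have -> : (n - b.+1 = 0)%N by lia.
have -> : (b.+1 - n = (b - n).+1)%N by lia.
split=> [oz|[oz lz]].
  split=> [i j i_n j_n aij ijb|i il].
    have [|zij zr zd] := oz i j i_n j_n aij; first lia.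
    by split=> // h1 h2; apply: zr => //; lia.
  rewrite !addn0 addSn addnS; apply/andP; split.
    by have [||||_ zr _] := oz i (i + (b - n))%N; [lia..|apply: zr; lia].
  by have [||||_ _ zd] := oz i (i + (b - n)).+1%N; [lia..|apply: zd; lia].
move=> i j i_n j_n aij ijb; have [ijb'|ijb'] := leqP (n + j) (i + b).
  have [zij zr zd] := oz i j i_n j_n aij ijb'.
  split=> // h1 h2; have [ijb2|ijb2] := ltnP (n + j) (i + b); first exact: zr.
  have /andP[+ _] := lz i ltac:(lia).
  have jE : (i + (b - n))%N = j by lia.
  by rewrite !addn0 addnS jE.
have jE : (i + (b - n)).+1 = j by lia.
have /andP[z1 z2] := lz i ltac:(lia); move: z1 z2.
rewrite !addn0 addnS addSn jE => z1 z2.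
have [||||/andP[z0 _] _ _] := oz i (i + (b - n))%N; [lia..|].
have [||||/andP[_ z3] _ _] := oz i.+1 j; [lia..|].
split=> [|h1 h2|//]; last lia.
by rewrite (ltW (le_lt_trans z0 z1)) (ltW (lt_le_trans z2 z3)).
Qed.

(** The mirror image below the main diagonal: the neighbours are now the entry above and the one to
    the right. *)
Lemma ordered_band_lt a b z : (0 < a)%N -> (a < n)%N -> (a < b)%N ->
  ordered_band a b z <-> ordered_band a.+1 b z /\
    forall i, (i < diag_len a)%N ->
      z (diag_pos a.+1 i) < z (diag_pos a i) < z (diag_pos a.+1 i.+1).
Proof.
rewrite /diag_len /diag_pos => a0 an ab.
have -> : (a - n = 0)%N by lia.
have -> : (a.+1 - n = 0)%N by lia.
have -> : (n - a = (n - a.+1).+1)%N by lia.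
split=> [oz|[oz lz]].
  split=> [i j i_n j_n aij ijb|i il].
    have [||zij zr zd] := oz i j i_n j_n; [lia..|].
    by split=> // h1 h2; apply: zd => //; lia.
  rewrite !addn0 addSn addnS; apply/andP; split.
    by have [||||_ _ zd] := oz (i + (n - a.+1))%N i; [lia..|apply: zd; lia].
  by have [||||_ zr _] := oz (i + (n - a.+1)).+1%N i; [lia..|apply: zr; lia].
move=> i j i_n j_n aij ijb; have [ijb'|ijb'] := leqP (i + a.+1) (n + j).
  have [zij zr zd] := oz i j i_n j_n ijb' ijb.
  split=> // h1 h2; have [ijb2|ijb2] := ltnP (i + a.+1) (n + j); first exact: zd.
  have /andP[+ _] := lz j ltac:(lia).
  have jE : (j + (n - a.+1))%N = i by lia.
  by rewrite !addn0 addnS jE.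
have jE : (j + (n - a.+1)).+1 = i by lia.
have /andP[z1 z2] := lz j ltac:(lia); move: z1 z2.
rewrite !addn0 addnS addSn jE => z1 z2.
have [||||/andP[z0 _] _ _] := oz (j + (n - a.+1))%N j; [lia..|].
have [||||/andP[_ z3] _ _] := oz i j.+1; [lia..|].
split=> [|//|h1 h2]; last lia.
by rewrite (ltW (le_lt_trans z0 z1)) (ltW (lt_le_trans z2 z3)).
Qed.

(** Here the removed diagonal is the longer one: its first entry has no neighbour above and its last
    none to the right, so 0 and 1 bound them instead. *)
Lemma ordered_band_slot a b z : (n <= a)%N -> (a.+1 < n + n)%N -> (a < b)%N ->
  ordered_band a b z <-> ordered_band a.+1 b z /\
    forall i, (i < diag_len a)%N ->
      z (diag_pos a i) \in slot (diag_len a.+1) (z \o diag_pos a.+1) i.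
Proof.
rewrite /diag_len /diag_pos => na a2n ab.
have -> : (n - a = 0)%N by lia.
have -> : (n - a.+1 = 0)%N by lia.
have -> : (a.+1 - n = (a - n).+1)%N by lia.
split=> [oz|[oz lz]].
  split=> [i j i_n j_n aij ijb|i il].
    have [||zij zr zd] := oz i j i_n j_n; [lia..|].
    by split=> // h1 h2; apply: zd => //; lia.
  rewrite !addn0 /slot /endpoint in_itv /=.
  have [||||z01 zr _] := oz i (i + (a - n))%N; [lia..|].
  apply/andP; split.
    case: i il z01 zr => [|i] il z01 zr /=; first by case/andP: z01.
    rewrite ifT; last lia.
    have [||||_ _ zd] := oz i (i + (a - n)).+1%N; [lia..|].
    by rewrite addn0 addnS addSn; apply: zd; lia.
  case: eqP => /= il'; first by rewrite ifF; [case/andP: z01|lia].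
  by rewrite ifT; [rewrite addn0 addnS; apply: zr; lia|lia].
move=> i j i_n j_n aij ijb; have [ijb'|ijb'] := leqP (i + a.+1) (n + j).
  have [zij zr zd] := oz i j i_n j_n ijb' ijb.
  split=> // h1 h2; have [ijb2|ijb2] := ltnP (i + a.+1) (n + j); first exact: zd.
  have := lz i.+1 ltac:(lia).
  rewrite !addn0 /slot /endpoint in_itv /= ifT ?addn0; last lia.
  have jE : (i + (a - n)).+1 = j by lia.
  by rewrite addnS addSn jE => /andP[].
have jE : (i + (a - n))%N = j by lia.
have := lz i ltac:(lia).
rewrite !addn0 jE /slot /endpoint in_itv /= => /andP[z1 z2].
split=> [|h1 h2|h1 h2]; last lia.
- apply/andP; split.
    case: i {aij ijb ijb' z2} i_n jE z1 => [//|i] i_n jE /=.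
    rewrite ifT ?addn0; last lia.
    have [||||/andP[z0 _] _ _] := oz i (i + (a - n).+1)%N; [lia..|].
    by move=> z1; rewrite ltW// (le_lt_trans z0).
  move: z2; case: eqP => /= il'; first by rewrite ifF//; lia.
  rewrite ifT ?addn0; last lia.
  have [||||/andP[_ z3] _ _] := oz i (i + (a - n).+1)%N; [lia..|].
  by move=> z2; rewrite ltW// (lt_le_trans z2).
- move: z2; rewrite ifT; last lia.
  by case: eqP => /= [|_]; [lia|rewrite addn0 addnS jE].
Qed.

Definition depends_on (D : pred (nat * nat)) K :=
  forall y z, (forall p, D p -> y p = z p) -> K y = K z.

(** Splits the indicator of a band into one that is constant in the integration and one-variable
    indicators; the sortedness [s] of the integrated diagonal is absorbed because interlacing forces
    it. *)
Lemma mul_indicators l (P P' : Prop) (c : nat -> bool) (s : bool) :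
  (P' <-> P /\ forall i, (i < l)%N -> c i) ->
  ((forall i, (i < l)%N -> c i) -> s) ->
  `[< P' >]%:R * s%:R = `[< P >]%:R * \prod_(i < l) (c i)%:R :> R.
Proof.
move=> P'E cs.
have [/forallP call|/forallPn[i0 ci0]] := boolP [forall i : 'I_l, c i].
  have c1 i : (i < l)%N -> c i by move=> il; exact: (call (Ordinal il)).
  rewrite cs// big1 ?mulr1 => [|i _]; last by rewrite call.
  by rewrite (asbool_equiv_eq (_ : P' <-> P))// P'E; split => [[]|].
rewrite (bigD1 i0)//= (negbTE ci0) mul0r mulr0 asboolF ?mul0r//.
by move=> /P'E[_ /(_ i0 (ltn_ord i0))]; rewrite (negbTE ci0).
Qed.

Lemma sorted_mkseq_lt (x : nat -> R) l :
  (forall i, (i.+1 < l)%N -> x i < x i.+1) -> sorted <=%R (mkseq x l).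
Proof.
move=> xlt; apply/(sortedP 0) => i; rewrite size_mkseq => il.
by rewrite !nth_mkseq ?ltW ?xlt// ltnW.
Qed.

Lemma weight0 l (x : nat -> R) : weight l 0 x = (sorted <=%R (mkseq x l))%:R *
  \det (\matrix_(i < l, j < l) (x i ^+ j)).
Proof. by rewrite /weight big1 ?mul1r// => i _; rewrite !expr0 mulr1. Qed.

(** Shared by both sides of the main diagonal: [d'] is the diagonal integrated out and [d] its
    longer neighbour. The factor [K] carries whatever is independent of [d']. *)
Lemma marginal_interlaced_band a b a' b' d' d :
  diag_len d = (diag_len d').+1 ->
  (forall z, ordered_band a' b' z <-> ordered_band a b z /\
    forall i, (i < diag_len d')%N ->
      z (diag_pos d i) < z (diag_pos d' i) < z (diag_pos d i.+1)) ->
  (forall p, (p.1 + a <= n + p.2 <= p.1 + b)%N -> p \notin diag_seq d') ->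
  (forall i, diag_pos d i \notin diag_seq d') ->
  exists2 C, 0 <= C & forall K z,
    depends_on [predC diag_seq d'] K ->
    marginal (diag_seq d') (fun y => (K y * `[< ordered_band a' b' y >]%:R
      * weight (diag_len d') 0 (y \o diag_pos d'))%:E) z
    = (K z * C * `[< ordered_band a b z >]%:R
      * weight (diag_len d) 0 (z \o diag_pos d))%:E.
Proof.
move=> len_d bandE band_d' d_d'.
exists (\prod_(j < diag_len d') j.+1%:R^-1).
  by apply: prodr_ge0 => j _; rewrite invr_ge0 ler0n.
move=> K z KD.
transitivity (marginal (diag_seq d') (fun y =>
    (K z * `[< ordered_band a b z >]%:R * \prod_(i < diag_len d')
      (z (diag_pos d i) < y (diag_pos d' i) < z (diag_pos d i.+1))%R%:R
    * \det (\matrix_(i < diag_len d', j < diag_len d')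
        (y (diag_pos d' i) ^+ j)))%:E) z).
  apply: eq_marginal => y yz; rewrite weight0 -(KD y)//.
  rewrite mulrA -(mulrA (K y)) (@mul_indicators (diag_len d') (ordered_band a b y)
    _ (fun i => y (diag_pos d i) < y (diag_pos d' i) < y (diag_pos d i.+1)))//.
    rewrite (asbool_equiv_eq (eq_ordered_band a b y z _)); last first.
      by move=> p /band_d' pd; apply: yz.
    rewrite -!mulrA; congr (_ * (_ * (_ * _)))%:E.
    have yd i : y (diag_pos d i) = z (diag_pos d i) by apply: yz; exact: d_d'.
    by apply: eq_bigr => i _; rewrite !yd.
  move=> lty; apply: sorted_mkseq_lt => i il.
  have /andP[_] := lty _ (ltnW il); move/lt_trans; apply.
  by have /andP[] := lty _ il.
rewrite [LHS](@marginal_interlacing _ _ _ (diag_pos d') (z \o diag_pos d));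
  last exact: diag_pos_inj.
by rewrite len_d weight0; congr EFin; rewrite !mulrA; congr (_ * _); ring.
Qed.

Lemma diag_seqE d p : p \in diag_seq d -> (n + p.2 = p.1 + d)%N.
Proof. by case/mapP => i _ ->; rewrite /diag_pos/=; lia. Qed.

Lemma diag_pos_notin d d' i : d != d' -> diag_pos d i \notin diag_seq d'.
Proof. by apply: contra => /diag_seqE; rewrite /diag_pos/=; lia. Qed.

(** With end slots at 0 and 1 the Dixon-Anderson integral applies, and each diagonal raises the
    exponent by one. *)
Lemma marginal_slotted_band a b :
  (n <= a)%N -> (a.+1 < n + n)%N -> (a < b)%N ->
  exists2 C, 0 <= C & forall K z,
    depends_on [predC diag_seq a] K ->
    marginal (diag_seq a) (fun y => (K y * `[< ordered_band a b y >]%:R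
      * weight (diag_len a) (a - n) (y \o diag_pos a))%:E) z
    = (K z * C * `[< ordered_band a.+1 b z >]%:R
      * weight (diag_len a.+1) (a.+1 - n) (z \o diag_pos a.+1))%:E.
Proof.
move=> na a2n ab; set l := diag_len a.+1.
have len_a : diag_len a = l.+1 by rewrite /l /diag_len; lia.
have [C C0 intC] := @marginal_interlacing01 R (nat * nat)%type l (a - n).
exists C => // K z KD.
transitivity (marginal (diag_seq a) (fun y =>
    (K z * `[< ordered_band a.+1 b z >]%:R * \prod_(i < l.+1)
      (y (diag_pos a i) \in slot l (z \o diag_pos a.+1) i)%:R
    * ((\prod_(i < l.+1) (y (diag_pos a i) ^+ (a - n)
          * (1 - y (diag_pos a i)) ^+ (a - n)))
      * \det (\matrix_(i < l.+1, j < l.+1) (y (diag_pos a i) ^+ j))))%:E) z).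
  apply: eq_marginal => y yz; rewrite /weight -(KD y)// len_a.
  have yd i : y (diag_pos a.+1 i) = z (diag_pos a.+1 i).
    by apply: yz; rewrite !inE diag_pos_notin// gtn_eqF.
  rewrite mulrA -(mulrA (K y)) (@mul_indicators l.+1 (ordered_band a.+1 b y)
    _ (fun i => y (diag_pos a i) \in slot l (y \o diag_pos a.+1) i)).
  - rewrite (asbool_equiv_eq (eq_ordered_band a.+1 b y z _)); last first.
      move=> p pd; apply: yz; apply: contraTN pd => /diag_seqE ->.
      by rewrite addnS ltnn.
    rewrite -!mulrA; congr (_ * (_ * (_ * _)))%:E.
    apply: eq_bigr => i _.
    by rewrite (_ : y \o _ = z \o diag_pos a.+1)//; apply/funext.
  - by rewrite ordered_band_slot// len_a.
  - move=> sl; apply: sorted_mkseq_lt => i il.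
    have := sl _ il; have := sl _ (ltnW il); rewrite /slot /endpoint !in_itv/=.
    have il' : (i < l)%N by [].
    by rewrite il' (ltn_eqF il') /= => /andP[_ /lt_trans lt1] /andP[/lt1].
(* The Dixon-Anderson integral wants the next diagonal inside [0, 1]. The band supplies this;
   outside the band both sides vanish. *)
have [oz|noz] := pselect (ordered_band a.+1 b z); last first.
  rewrite asboolF// !mulr0 !mul0r -[RHS](marginal_0 (diag_seq a) z).
  congr marginal; by apply/funext => y; rewrite !mul0r.
rewrite /diag_seq len_a [LHS]intC; last 2 first.
- exact: diag_pos_inj.
- move=> i; rewrite /l /diag_len => il.
  by have [||||z01 _ _] := oz (i + (n - a.+1))%N (i + (a.+1 - n))%N; [lia..|].
rewrite /weight -/l subSn//; congr EFin; rewrite !mulrA.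
by congr (_ * _); congr (_ * _); ring.
Qed.

(** * Integrating out all diagonals on one side *)

Lemma sub_depends_on (D D' : pred (nat * nat)) K :
  (forall p, D p -> D' p) -> depends_on D K -> depends_on D' K.
Proof. by move=> DD' KD y z yz; apply: KD => p /DD'; exact: yz. Qed.

Lemma depends_on_mulr D K C : depends_on D K -> depends_on D (fun y => K y * C).
Proof. by move=> KD y z yz; rewrite (KD y z). Qed.

Lemma weight1 x : weight 1 0 x = 1.
Proof. by rewrite weight0 det_mx11 mxE mulr1. Qed.

(** The corner diagonal is innermost, so it is integrated first. The induction starts at the corner,
    where a diagonal of one entry has weight 1. *)
Lemma marginal_diags_gt t a b :
  (n <= b)%N -> (b + t.+1 = n + n)%N -> (a <= b)%N ->
  exists2 C, 0 <= C & forall K z,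
    depends_on [pred p | (n + p.2 <= p.1 + b)%N] K ->
    marginal (diags (iota b.+1 t))
      (fun y => (K y * `[< ordered_band a (n + n).-1 y >]%:R)%:E) z
    = (K z * C * `[< ordered_band a b z >]%:R
      * weight (diag_len b) 0 (z \o diag_pos b))%:E.
Proof.
elim: t b => [|t IH] b nb bt ab.
  exists 1 => // K z _ /=; have -> : diag_len b = 1%N by rewrite /diag_len; lia.
  by rewrite weight1 !mulr1; congr (_ * `[< ordered_band a _ z >]%:R)%:E; lia.
have [|||C C0 intC] := IH b.+1; [lia..|].
have [|z|p|i|C' C'0 intC'] := @marginal_interlaced_band a b a b.+1 b.+1 b.
- by rewrite /diag_len; lia.
- by apply: ordered_band_gt => //; lia.
- by case: p => p1 p2 /= pab; apply/negP => /diag_seqE /=; lia.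
- by rewrite diag_pos_notin// ltn_eqF.
exists (C * C'); first exact: mulr_ge0.
move=> K z KD; rewrite /diags /= marginal_cat.
transitivity (marginal (diag_seq b.+1) (fun y => (K y * C
    * `[< ordered_band a b.+1 y >]%:R
    * weight (diag_len b.+1) 0 (y \o diag_pos b.+1))%:E) z).
  congr marginal; apply/funext => y; apply: intC.
  by apply: sub_depends_on KD => p /=; lia.
rewrite intC' ?mulrA//; apply: depends_on_mulr.
apply: sub_depends_on KD => -[p1 p2] /= pb; by apply/negP => /diag_seqE /=; lia.
Qed.

(** The list is reversed to integrate from the lower left corner inwards. The truncated exponent
    [a - n] stays 0 up to the main diagonal and then grows. *)
Lemma marginal_diags_lt a b : (0 < a)%N -> (a <= b)%N -> (b < n + n)%N ->
  exists2 C, 0 <= C & forall K z,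
    depends_on [pred p | (p.1 + a <= n + p.2)%N] K ->
    marginal (diags (rev (iota 1 a.-1)))
      (fun y => (K y * `[< ordered_band 1 b y >]%:R)%:E) z
    = (K z * C * `[< ordered_band a b z >]%:R
      * weight (diag_len a) (a - n) (z \o diag_pos a))%:E.
Proof.
case: a => // a _; elim: a => [|a IH] ab b2n.
  exists 1 => // K z _ /=; have -> : diag_len 1 = 1%N by rewrite /diag_len; lia.
  by rewrite (_ : 1 - n = 0)%N ?weight1 ?mulr1//; lia.
have [||C C0 intC] := IH; [lia..|].
have [C' C'0 intC'] : exists2 C, 0 <= C & forall K z,
    depends_on [predC diag_seq a.+1] K ->
    marginal (diag_seq a.+1) (fun y => (K y * `[< ordered_band a.+1 b y >]%:R
      * weight (diag_len a.+1) (a.+1 - n) (y \o diag_pos a.+1))%:E) z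
    = (K z * C * `[< ordered_band a.+2 b z >]%:R
      * weight (diag_len a.+2) (a.+2 - n) (z \o diag_pos a.+2))%:E.
  (* Before the main diagonal the next diagonal is longer and plain interlacing applies; from it on
     the next one is shorter. *)
  have [an|na] := ltnP a.+1 n; last by apply: marginal_slotted_band; lia.
  have -> : (a.+1 - n = 0)%N by lia.
  have -> : (a.+2 - n = 0)%N by lia.
  apply: marginal_interlaced_band => [|z|p|i].
  - by rewrite /diag_len; lia.
  - by apply: ordered_band_lt => //; lia.
  - by case: p => p1 p2 /= pab; apply/negP => /diag_seqE /=; lia.
  - by rewrite diag_pos_notin// gtn_eqF.
exists (C * C'); first exact: mulr_ge0.
move=> K z KD; rewrite (_ : rev _ = a.+1 :: rev (iota 1 a)); last first.
  transitivity (rev (iota 1 (a + 1))); first by rewrite addn1.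
  by rewrite iotaD rev_cat add1n.
rewrite /diags /= marginal_cat.
transitivity (marginal (diag_seq a.+1) (fun y => (K y * C
    * `[< ordered_band a.+1 b y >]%:R
    * weight (diag_len a.+1) (a.+1 - n) (y \o diag_pos a.+1))%:E) z).
  congr marginal; apply/funext => y; apply: intC.
  by apply: sub_depends_on KD => p /=; lia.
rewrite intC' ?mulrA//; apply: depends_on_mulr.
apply: sub_depends_on KD => -[p1 p2] /= pb; by apply/negP => /diag_seqE /=; lia.
Qed.

End Diagonals.

(** * Measurability *)

Section Measurability.
Context {R : realType}.

Lemma measurable_pred_set d (X : measurableType d) (b : X -> bool) :
  measurable_fun setT b -> measurable [set x | b x].
Proof.
by move=> mb; rewrite -[X in measurable X]setTI; exact: (mb _ [set true]).
Qed.

Lemma measurable_all_ord d (X : measurableType d) m (A : 'I_m -> set X) :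
  (forall i, measurable (A i)) -> measurable [set x | forall i, A i x].
Proof.
move=> mA; rewrite (_ : [set x | _] = \bigcap_(i in [set: 'I_m]) A i).
  by apply: fin_bigcap_measurable => // i _.
by apply/seteqP; split => x /= Ax i; [move=> _|]; exact: Ax.
Qed.

Lemma measurable_coord k (i : 'I_k) :
  measurable_fun setT (fun t : Rvec R k => tnth t i : measurableTypeR R).
Proof. exact: measurable_tnth. Qed.

Lemma measurable_tnth_itv k (i : 'I_k) (I : interval R) :
  measurable [set t : Rvec R k | (tnth t i : R) \in I].
Proof.
rewrite -[X in measurable X]setTI.
by apply: (@measurable_coord k i measurableT [set` I]); exact: measurable_itv.
Qed.

Lemma measurable_tnth_lt k (i j : 'I_k) :
  measurable [set t : Rvec R k | (tnth t i : R) < tnth t j].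
Proof.
by apply: measurable_pred_set; apply: measurable_fun_ltr; exact: measurable_tnth.
Qed.

Lemma measurable_tnth_le k (i j : 'I_k) :
  measurable [set t : Rvec R k | (tnth t i : R) <= tnth t j].
Proof.
by apply: measurable_pred_set; apply: measurable_fun_ler; exact: measurable_tnth.
Qed.

Lemma measurable_imply d (X : measurableType d) (P : Prop) (A : set X) :
  measurable A -> measurable [set x | P -> A x].
Proof.
move=> mA; have [p|np] := pselect P.
  by rewrite (_ : [set x | _] = A)//; apply/seteqP; split => x /=; [exact|].
rewrite (_ : [set x | _] = setT); first exact: measurableT.
by apply/seteqP; split=> // x _ /np.
Qed.

Lemma measurable_unit_cube k : measurable (unit_cube R k).
Proof.
rewrite (_ : unit_cube R k =
    [set t | forall i, [set t : Rvec R k | (tnth t i : R) \in `[0, 1]] t]).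
  by apply: measurable_all_ord => i; exact: measurable_tnth_itv.
by apply/seteqP; split => t /= + i; move=> /(_ i); rewrite in_itv.
Qed.

Lemma measurable_Yset m n : measurable (Yset R m n).
Proof.
rewrite (_ : Yset R m n =
  [set y | forall i j, ([set y | entry y i j \in `[0, 1]] `&`
    ([set y | forall j' : 'I_n, j' = j.+1 :> nat ->
        entry y i j < entry y i j'] `&`
     [set y | forall i' : 'I_m, i' = i.+1 :> nat ->
        entry y i j < entry y i' j])) y]).
  apply: measurable_all_ord => i; apply: measurable_all_ord => j.
  apply: measurableI; first exact: measurable_tnth_itv.
  by apply: measurableI; apply: measurable_all_ord => i';
    apply: measurable_imply; exact: measurable_tnth_lt.
apply/seteqP; split => y /= h i j.
  by have [h1 h2 h3] := h i j; rewrite in_itv.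
by have [h1 [h2 h3]] := h i j; rewrite in_itv in h1.
Qed.

Lemma measurable_sorted k : measurable [set t : Rvec R k | sorted <=%R t].
Proof.
rewrite (_ : mkset _ = [set t | forall i j : 'I_k, j = i.+1 :> nat ->
    (tnth t i : R) <= tnth t j]).
  apply: measurable_all_ord => i; apply: measurable_all_ord => j.
  by apply: measurable_imply; exact: measurable_tnth_le.
apply/seteqP; split => t /=.
  by move=> /(sortedP 0) st i j ij; rewrite !(tnth_nth 0) ij st// size_tuple -ij.
move=> ht; apply/(sortedP 0) => i; rewrite size_tuple => ik.
by have := ht (Ordinal (ltnW ik)) (Ordinal ik) erefl; rewrite !(tnth_nth 0).
Qed.

Lemma measurable_diagonal_weight n k :
  measurable_fun setT (fun t : Rvec R k => diagonal_weight n t).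
Proof.
have mc i := @measurable_coord k i.
apply: measurable_funM; first apply: measurable_funM.
- rewrite (_ : (fun t : Rvec R k => _) = \1_[set t : Rvec R k | sorted <=%R t]).
    by apply/measurable_indicP; exact: (measurable_sorted k).
  by apply/funext => t; rewrite indicE mem_setE.
- apply: measurable_funX; apply: measurable_prod => i _.
  rewrite (_ : (fun t : Rvec R k => _) = (fun t : Rvec R k => \prod_(j < k)
      (if (i < j)%N then (tnth t i : R) - tnth t j else 1))); last first.
    by apply/funext => t; rewrite big_mkcond.
  apply: measurable_prod => j _; case: (i < j)%N; last exact: measurable_cst.
  by apply: measurable_funB; exact: mc.
- apply: measurable_prod => i _; apply: measurable_funM; apply: measurable_funX.
    exact: mc.
  by apply: measurable_funB; [exact: measurable_cst|exact: mc].
Qed.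

Lemma diagonal_weight_ge0 n k (t : k.-tuple R) :
  unit_cube R k t -> 0 <= diagonal_weight n t.
Proof.
move=> t01; apply: mulr_ge0; first by apply: mulr_ge0; rewrite ?sqr_ge0.
apply: prodr_ge0 => i _; have /andP[t0 t1] := t01 i.
by apply: mulr_ge0; apply: exprn_ge0; rewrite ?subr_ge0.
Qed.

(** The density is the product of the two sides: the sortedness indicator is idempotent, and
    squaring removes the sign between [vandermonde] and the determinant. *)
Lemma diagonal_weightE n k (t : k.-tuple R) :
  diagonal_weight n t = weight k 0 (nth 0 t) * weight k (n - k) (nth 0 t).
Proof.
have tE : mkseq (nth 0 t) k = t by have := mkseq_nth 0 t; rewrite size_tuple.
rewrite weight0 /weight tE.
set D := \det _; set S : R := (sorted _ _)%:R.
have SS : S * S = S by rewrite /S -natrM mulnb andbb.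
have -> : D = \det (Vandermonde k (\row_(j < k) tnth t j)).
  rewrite -det_tr; congr (\det _); apply/matrixP => i j; rewrite !mxE.
  by rewrite (tnth_nth 0).
have -> : diagonal_weight n t = S * vandermonde t ^+ 2 *
    \prod_(i < k) (nth 0 t i ^+ (n - k) * (1 - nth 0 t i) ^+ (n - k)).
  by congr (_ * _); apply: eq_bigr => i _; rewrite !(tnth_nth 0).
have -> : vandermonde t ^+ 2 = \det (Vandermonde k (\row_(j < k) tnth t j)) ^+ 2.
  rewrite det_Vandermonde /vandermonde -!prodrXl; apply: eq_bigr => i _.
  by rewrite -!prodrXl; apply: eq_bigr => j _; rewrite !mxE -sqrrN opprB.
rewrite -{1}SS; ring.
Qed.

End Measurability.

(** * The volume over a diagonal *)

Section DiagonalVolume.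
Context {R : realType}.
Variables (n k : nat) (kn : (k <= n)%N).

Definition mxvec_pos (t : 'I_(n * n)) : nat * nat :=
  let p := enum_val (cast_ord (esym (mxvec_cast n n)) t) in (p.1 : nat, p.2 : nat).

Lemma mxvec_posE i j : mxvec_pos (mxvec_index i j) = (i : nat, j : nat).
Proof. by rewrite /mxvec_pos /mxvec_index cast_ordK enum_rankK. Qed.

Lemma mxvec_pos_inj : injective mxvec_pos.
Proof.
move=> s t; case/mxvec_indexP: s => i j; case/mxvec_indexP: t => i' j'.
by rewrite !mxvec_posE => -[/val_inj -> /val_inj ->].
Qed.

Lemma perm_mxvec_pos s : perm_eq s (iota 1 (n + n).-1) ->
  perm_eq [seq mxvec_pos t | t <- enum 'I_(n * n)] (diags n s).
Proof.
move=> s_iota; apply: uniq_perm.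
- by rewrite map_inj_uniq ?enum_uniq//; exact: mxvec_pos_inj.
- rewrite /diags /diag_seq; apply: allpairs_uniq_dep.
  + by rewrite (perm_uniq s_iota) iota_uniq.
  + by move=> a _; exact: iota_uniq.
  + move=> [a i] [a' i'] _ _ /= []; rewrite /diag_pos => h1 h2.
    have [-> ->]: a = a' /\ i = i' by lia.
    by [].
move=> -[i j]; apply/mapP/flatten_mapP => [[t _ ->]|[a]].
  case/mxvec_indexP: t => {}i {}j; rewrite mxvec_posE.
  have ? := ltn_ord i; have ? := ltn_ord j.
  (* Cell (i, j) lies on diagonal n + j - i, at index min(i, j). *)
  exists (n + j - i)%N; first by rewrite (perm_mem s_iota) mem_iota; lia.
  apply/mapP; exists (minn i j); first by rewrite mem_iota /diag_len; lia.
  by rewrite /diag_pos; congr pair; lia.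
rewrite (perm_mem s_iota) mem_iota => a2n /mapP[l].
rewrite mem_iota /diag_len /diag_pos => ll [iE jE].
have i_n : (i < n)%N by lia.
have j_n : (j < n)%N by lia.
exists (mxvec_index (Ordinal i_n) (Ordinal j_n)); first by rewrite mem_enum.
by rewrite mxvec_posE.
Qed.

Lemma Yset_ordered_band (z : nat * nat -> R) :
  Yset R n n (coords (n * n) mxvec_pos z) <-> ordered_band n 1 (n + n).-1 z.
Proof.
have pE i j : entry (coords (n * n) mxvec_pos z) i j = z (i : nat, j : nat).
  by rewrite /entry tnth_mktuple mxvec_posE.
split=> [Yz i j i_n j_n _ _|oz i j].
  have [] := Yz (Ordinal i_n) (Ordinal j_n); rewrite !pE/= => z01 zr zd.
  split=> // h _.
    by have := zr (Ordinal h) erefl; rewrite !pE.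
  by have := zd (Ordinal h) erefl; rewrite !pE.
have i_n := ltn_ord i; have j_n := ltn_ord j.
have [||z01 zr zd] := oz i j i_n j_n; [lia..|].
rewrite !pE; split=> // [j' j'E|i' i'E]; rewrite !pE.
  by have := ltn_ord j'; rewrite j'E => ?; apply: zr; lia.
by have := ltn_ord i'; rewrite i'E => ?; apply: zd; lia.
Qed.

(** The index of the chosen diagonal j - i = n - k, which has k entries. *)
Let m := (n + (n - k))%N.

Lemma diag_tuple_coords (z : nat * nat -> R) :
  diag_tuple kn (coords (n * n) mxvec_pos z) = coords k (diag_pos n m) z.
Proof.
apply: eq_from_tnth => i; rewrite !tnth_mktuple /entry tnth_mktuple mxvec_posE.
by rewrite /diag_pos /m /=; congr (z (_, _)); lia.
Qed.

Lemma unit_cube_ordered_band (z : nat * nat -> R) : (0 < k)%N ->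
  ordered_band n m m z <-> unit_cube R k (coords k (diag_pos n m) z).
Proof.
move=> k0; split=> [oz i|cz i j i_n j_n aij ijb].
  rewrite tnth_mktuple /diag_pos /m; have ? := ltn_ord i.
  by have [||||] := oz (i + (n - m))%N (i + (m - n))%N; rewrite /m; [lia..|].
have i_k : (i < k)%N by move: aij ijb; rewrite /m; lia.
have := cz (Ordinal i_k); rewrite tnth_mktuple /= (_ : diag_pos n m i = (i, j)).
  by move=> zij; split=> //; lia.
by rewrite /diag_pos; move: aij ijb; rewrite /m => ? ?; congr pair; lia.
Qed.

Lemma eq_weight l e (x y : nat -> R) :
  (forall i, (i < l)%N -> x i = y i) -> weight l e x = weight l e y.
Proof.
move=> xy; rewrite /weight.
have -> : mkseq x l = mkseq y l.
  by apply/eq_in_map => i; rewrite mem_iota => il; exact: xy.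
congr (_ * (_ * _)); first by apply: eq_bigr => i _; rewrite xy.
by congr (\det _); apply/matrixP => i j; rewrite !mxE xy.
Qed.

Lemma measurable_diag_tuple :
  measurable_fun setT (diag_tuple kn : Rvec R (n * n) -> Rvec R k).
Proof.
apply/measurable_fun_tnthP => i.
rewrite (_ : _ \o _ = fun y : Rvec R (n * n) => tnth y (mxvec_index (widen_ord kn i)
    (cast_ord (subnK kn) (rshift (n - k) i)))); first exact: measurable_tnth.
by apply/funext => y /=; rewrite tnth_mktuple.
Qed.

(** The law before normalization: [C] is the product of the constants of the two sides and is the
    same for every [A]. *)
Lemma diagonal_volume : (0 < k)%N -> exists2 C : R, 0 <= C & forall A,
  measurable A ->
  @lebesgue_vec R (n * n) (diag_tuple kn @^-1` A `&` Yset R n n)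
    = (\int[@lebesgue_vec R k]_(t in A `&` unit_cube R k)
         (C * diagonal_weight n t)%:E)%E.
Proof.
move=> k0.
have [|||C1 C10 int1] := @marginal_diags_gt R n (k.-1) 1 m; rewrite /m; [lia..|].
have [|||C2 C20 int2] := @marginal_diags_lt R n m m; rewrite /m; [lia..|].
exists (C1 * C2); first exact: mulr_ge0.
move=> A mA; set E := _ `&` Yset R n n.
have mE : measurable E.
  apply: measurableI; last exact: measurable_Yset.
  by rewrite -[X in measurable X]setTI; exact: measurable_diag_tuple.
pose z0 : nat * nat -> R := fun=> 0.
pose K (z : nat * nat -> R) : R := \1_A (coords k (diag_pos n m) z).
have K_dep (D : pred (nat * nat)) : (forall i, (i < k)%N -> D (diag_pos n m i)) ->
    depends_on D K.
  move=> Dm y z yz; rewrite /K; congr (\1_A _).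
  by apply: eq_from_tnth => i; rewrite !tnth_mktuple yz// Dm.
have W_dep (D : pred (nat * nat)) C :
    (forall i, (i < k)%N -> D (diag_pos n m i)) ->
    depends_on D (fun z => K z * C * weight k 0 (z \o diag_pos n m)).
  move=> Dm y z yz; rewrite (K_dep D Dm y z yz); congr (_ * _).
  by apply: eq_weight => i ik; rewrite /= yz// Dm.
have len_m : diag_len n m = k by rewrite /diag_len /m; lia.
transitivity (\int[@lebesgue_vec R (n * n)]_y (\1_E y)%:E)%E.
  by rewrite integral_indic// setIT.
rewrite (integral_lebesgue_vec _ mxvec_pos _ z0); last 3 first.
- exact: mxvec_pos_inj.
- by move=> t; rewrite lee_fin.
- by apply/measurable_EFinP; exact: measurable_indic.
(* Diagonal [m] becomes outermost, so that the other diagonals are integrated with its entries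
   fixed. *)
rewrite (perm_marginal _ (diags n (m :: rev (iota 1 m.-1) ++ iota m.+1 k.-1)));
  last 3 first.
- by move=> z; rewrite lee_fin.
- move=> d X c mc; rewrite -compA; apply: measurableT_comp.
    by apply/measurable_EFinP; exact: measurable_indic.
  exact: measurable_coords.
- apply: perm_mxvec_pos.
  have -> : (n + n).-1 = (m.-1 + k)%N by rewrite /m; lia.
  rewrite iotaD -cat1s perm_catCA; apply: perm_cat; first by rewrite perm_rev.
  have -> : (1 + m.-1 = m)%N by rewrite /m; lia.
  by rewrite -{2}(prednK k0).
rewrite /diags /= marginal_cat.
transitivity (marginal (diag_seq n m) (fun z => (K z * C1 * C2
    * `[< ordered_band n m m z >]%:R
    * diagonal_weight n (coords k (diag_pos n m) z))%:E) z0).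
  congr marginal; apply/funext => z; rewrite map_cat flatten_cat marginal_cat.
  (* The diagonals beyond [m] go first; the [weight] they leave reads only diagonal [m], so it joins
     the factor in front for the second integration. *)
  transitivity (marginal (diags n (rev (iota 1 m.-1))) (fun y =>
      (K y * C1 * weight k 0 (y \o diag_pos n m)
       * `[< ordered_band n 1 m y >]%:R)%:E) z).
    congr marginal; apply/funext => y.
    transitivity (marginal (diags n (iota m.+1 k.-1)) (fun y =>
        (K y * `[< ordered_band n 1 (n + n).-1 y >]%:R)%:E) y).
      congr marginal; apply/funext => x; rewrite /= /K !indicE.
      rewrite (_ : (_ \in E) = (coords k (diag_pos n m) x \in A)
        && `[< ordered_band n 1 (n + n).-1 x >]) -?mulnb ?natrM//.
      apply/idP/andP => [|[]].
        rewrite inE => -[Ax Yx]; split; first by rewrite inE -diag_tuple_coords.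
        by apply/asboolP/Yset_ordered_band.
      move=> /set_mem Ax /asboolP ox; apply/mem_set.
      split; last exact/Yset_ordered_band.
      by rewrite /preimage /= diag_tuple_coords.
    rewrite int1 ?len_m; first by congr EFin; ring.
    by apply: K_dep => i ik; rewrite /= /diag_pos /m; lia.
  rewrite (int2 (fun y => K y * C1 * weight k 0 (y \o diag_pos n m))); last first.
    by apply: W_dep => i ik; rewrite /= /diag_pos /m; lia.
  rewrite len_m diagonal_weightE (_ : m - n = n - k)%N; last by rewrite /m; lia.
  have Wz e : weight k e (nth 0 (coords k (diag_pos n m) z))
      = weight k e (z \o diag_pos n m).
    apply: eq_weight => i ik.
    by rewrite -[i]/(nat_of_ord (Ordinal ik)) -tnth_nth tnth_mktuple.
  by rewrite !Wz; congr EFin; ring.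
rewrite integral_mkcond.
rewrite (integral_lebesgue_vec _ (fun i : 'I_k => diag_pos n m i) _ z0);
  last 3 first.
- by move=> i j ij; apply: val_inj; apply: (@diag_pos_inj n m k) ij; exact: ltn_ord.
- move=> t; rewrite patchE; case: ifPn => //; rewrite inE => -[_ t01].
  rewrite lee_fin; apply: mulr_ge0; first exact: mulr_ge0.
  exact: diagonal_weight_ge0.
- have mD : measurable (A `&` unit_cube R k).
    by apply: measurableI => //; exact: measurable_unit_cube.
  apply/(measurable_restrictT _ mD); apply: measurable_funTS; apply/measurable_EFinP.
  apply: measurable_funM; first exact: measurable_cst.
  exact: measurable_diagonal_weight.
rewrite (_ : [seq _ | i <- enum 'I_k] = diag_seq n m); last first.
  by rewrite /diag_seq len_m -val_enum_ord -map_comp.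
congr marginal; apply/funext => z; rewrite /= patchE.
rewrite (_ : (_ \in _ `&` _) = (coords k (diag_pos n m) z \in A)
  && `[< ordered_band n m m z >]).
  rewrite /K indicE; case: (_ \in A) => /=; last by rewrite !mul0r.
  by case: asboolP => _; rewrite ?mulr0 ?mul0r// !mul1r mulr1.
rewrite in_setI; congr (_ && _); apply/idP/asboolP; rewrite inE.
  by move/(unit_cube_ordered_band _ k0).
by move/(unit_cube_ordered_band _ k0).
Qed.

End DiagonalVolume.

(** * Normalization to a probability density *)

Theorem theorem3 (R : realType) (d : measure_display) (Omega : measurableType d)
    (P : probability Omega R) (n : nat) (n_gt0 : (0 < n)%N)
    (Y : {RV P >-> Rvec R (n * n)})
    (Y_uniform :
      uniform_on (@lebesgue_vec R (n * n)) (Yset R n n) (distribution P Y))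
    (k : nat) (k_gt0 : (1 <= k)%N) (k_le_n : (k <= n)%N) :
  exists2 c : R, 0 < c &
    has_density_on (@lebesgue_vec R k) (unit_cube R k)
      (fun x => c * diagonal_weight n x)
      (pushforward P (fun w => diag_tuple k_le_n (Y w) : Rvec R k)).
Proof.
have [C C0 vol] := @diagonal_volume R n k k_le_n k_gt0.
(* If the volume were 0 or infinite, the quotient in [uniform_on] would give the whole space mass 0
   instead of 1. *)
have [r r_gt0 rE] : exists2 r : R, 0 < r &
    @lebesgue_vec R (n * n) (Yset R n n) = r%:E.
  have := Y_uniform setT measurableT; rewrite setTI probability_setT.
  have : (0 <= @lebesgue_vec R (n * n) (Yset R n n))%E by exact: measure_ge0.
  case: (@lebesgue_vec R (n * n) (Yset R n n)) => [r||]//.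
  - rewrite lee_fin le_eqVlt => /predU1P[<-|r0 _]; last by exists r.
    by rewrite mul0e => -[] /eqP; rewrite oner_eq0.
  - by move=> _; rewrite invey mule0 => -[] /eqP; rewrite oner_eq0.
(* With [C = 0] the volume formula for the whole space would contradict [0 < r]. *)
have C_gt0 : 0 < C.
  rewrite lt_neqAle C0 andbT; apply/eqP => C_eq0.
  have := vol setT measurableT; rewrite preimage_setT setTI rE -C_eq0.
  under eq_integral do rewrite mul0r.
  by rewrite integral0 => -[] /eqP; rewrite gt_eqF.
exists (C / r); first exact: divr_gt0.
split=> [|x x01|A mA].
- apply: measurable_funTS; apply: measurable_funM; first exact: measurable_cst.
  exact: measurable_diagonal_weight.
- by apply: mulr_ge0; [apply/ltW/divr_gt0|exact: diagonal_weight_ge0].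
have mdA : measurable (diag_tuple k_le_n @^-1` A : set (Rvec R (n * n))).
  by rewrite -[X in measurable X]setTI; exact: measurable_diag_tuple.
rewrite -[LHS]/(distribution P Y (diag_tuple k_le_n @^-1` A)).
rewrite Y_uniform// rE vol//.
rewrite inver gt_eqF// muleC -ge0_integralZl//; last 4 first.
- by apply: measurableI => //; exact: measurable_unit_cube.
- apply: measurable_funTS; apply/measurable_EFinP.
  apply: measurable_funM; first exact: measurable_cst.
  exact: measurable_diagonal_weight.
- move=> x [_ x01]; rewrite lee_fin; apply: mulr_ge0 => //.
  exact: diagonal_weight_ge0.
- by rewrite lee_fin invr_ge0 ltW.
by apply: eq_integral => x _; rewrite -EFinM mulrA (mulrC C).
Qed.
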